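(* Let $m\in\mathbb{N}$, $\eta>0$, $\gamma>0$, $0\le\alpha\le 1$, $s\in\mathbb{N}\cup\{0\}$, $\phi\in C[0,1]$ and $z\in[0,1]$. Then $$\left|\Re_{m,\eta,\gamma}^{(\alpha,s)}(\phi;z)-\phi(z)\right|\le 2\,\omega\!\left(\phi;\sqrt{\varphi_{m,\eta,\gamma}^{(\alpha,s)}(z)}\right),$$ where $\varphi_{m,\eta,\gamma}^{(\alpha,s)}(z)=\Re_{m,\eta,\gamma}^{(\alpha,s)}((t-z)^2;z)$ is the second central moment.
   Context: $\mathbb{N}$ denotes the positive integers, and $C[0,1]$ the real-valued continuous functions on $[0,1]$. Binomial coefficients are $\binom{a}{b}=\frac{a!}{b!(a-b)!}$ if $0\le b\le a$ and $0$ otherwise; a term whose binomial coefficient is $0$ is understood to be $0$, and $0^0=1$. For $m\in\mathbb{N}$, $0\le j\le m$, $0\le\alpha\le1$, $s\in\mathbb{N}\cup\{0\}$ and $z\in[0,1]$ put: if $m<s$, $$q_{m,j}^{(\alpha,s)}(z)=\binom{m}{j}z^j(1-z)^{m-j};$$ if $m\ge s$, $$q_{m,j}^{(\alpha,s)}(z)=(1-\alpha)\binom{m-s}{j-s}z^{j-s+1}(1-z)^{m-j}+(1-\alpha)\binom{m-s}{j}z^{j}(1-z)^{m-s-j+1}+\alpha\binom{m}{j}z^j(1-z)^{m-j}.$$ For $\eta>0$, $\gamma>0$ and $\phi\in C[0,1]$ define, with $\Gamma$ the Gamma function, $$\Re_{m,\eta,\gamma}^{(\alpha,s)}(\phi;z)=\Gamma(\eta+1)\sum_{j=0}^{m}q_{m,j}^{(\alpha,s)}(z)\int_0^1\frac{(1-t)^{\eta-1}}{\Gamma(\eta)}\,\phi\!\left(\frac{j+t^{\gamma}}{m+1}\right)dt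 .$$ The notation $\Re_{m,\eta,\gamma}^{(\alpha,s)}((t-z)^2;z)$ means the operator applied to the function $t\mapsto(t-z)^2$ with $z$ fixed, evaluated at $z$. The modulus of continuity of $\phi\in C[0,1]$ is, for $\lambda>0$, $\omega(\phi;\lambda)=\sup\{|\phi(u+\vartheta)-\phi(u)|:0<\vartheta\le\lambda,\ u,u+\vartheta\in[0,1]\}$. *)

(* Defs.v *)
(* MathComp / MathComp-Analysis, over an arbitrary [R : realType]. *)
From HB Require Import structures.
From mathcomp Require Import all_boot all_order all_algebra.
From mathcomp Require Import all_classical all_reals all_analysis.

Set Implicit Arguments.
Unset Strict Implicit.
Unset Printing Implicit Defensive.

Import Order.TTheory GRing.Theory Num.Theory.
Import numFieldNormedType.Exports.

Local Open Scope classical_set_scope.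
Local Open Scope ring_scope.

(* Euler's Gamma function; meaningful for [0 < x], where the integral
   converges. *)
Definition Gamma (R : realType) (x : R) : R :=
  \int[@lebesgue_measure R]_(t in `]0, +oo[) (t `^ (x - 1) * expR (- t)).

(* Subtraction on [nat] is truncated: when [j < s] the coefficient
   binom(m-s, j-s) is 0 by convention whereas ['C(m - s, j - s)] would be 1,
   hence the test on [s <= j].  In the second summand ['C(m - s, j)] already
   vanishes for [m - s < j], the only case where the exponent [m - s - j]
   is truncated. *)
Definition qbasis (R : realType) (m j : nat) (alpha : R) (s : nat) (z : R) : R :=
  if (m < s)%N then 'C(m, j)%:R * z ^+ j * (1 - z) ^+ (m - j)
  else
    (if (s <= j)%N then
       (1 - alpha) * 'C(m - s, j - s)%:R * z ^+ (j - s + 1) * (1 - z) ^+ (m - j)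
     else 0)
    + (1 - alpha) * 'C(m - s, j)%:R * z ^+ j * (1 - z) ^+ (m - s - j + 1)
    + alpha * 'C(m, j)%:R * z ^+ j * (1 - z) ^+ (m - j).

Definition frac_op (R : realType) (m : nat) (eta gamma alpha : R) (s : nat)
    (phi : R -> R) (z : R) : R :=
  Gamma (eta + 1) *
  \sum_(0 <= j < m.+1)
    qbasis m j alpha s z *
    \int[@lebesgue_measure R]_(t in `[0, 1])
      ((1 - t) `^ (eta - 1) / Gamma eta
       * phi ((j%:R + t `^ gamma) / (m%:R + 1))).

Definition second_moment (R : realType) (m : nat) (eta gamma alpha : R)
    (s : nat) (z : R) : R :=
  frac_op m eta gamma alpha s (fun t => (t - z) ^+ 2) z.

(* Modulus of continuity on [0, 1] of (the restriction of) [phi]. *)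
Definition modulus (R : realType) (phi : R -> R) (lambda : R) : R :=
  sup [set r : R | exists u h : R,
    [/\ 0 < h <= lambda, 0 <= u <= 1, 0 <= u + h <= 1
      & r = `|phi (u + h) - phi u|] ].

(* Main.v *)
(* The weights q_j are nonnegative and sum to 1, and Gamma (eta + 1) = eta Gamma eta
   makes the operator a positive functional preserving constants. A chain of steps
   of length at most d gives |phi x - phi z| <= (1 + (x - z)^2 / d^2) modulus phi d;
   applying the operator and taking d^2 equal to the second moment M yields the
   factor 1 + M / d^2 = 2. Since sup of the empty set is 0 here, d must be
   nonzero: M > 0 because some q_j is positive and (j + t^gamma) / (m + 1) equals z
   for at most one t. *)

Require Import Defs.
From HB Require Import structures.
From mathcomp Require Import all_boot all_order all_algebra.
From mathcomp Require Import all_classical all_reals all_analysis.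
From mathcomp Require Import measurable_realfun ring lra.

Import Order.TTheory GRing.Theory Num.Theory.
Import numFieldNormedType.Exports.

Local Open Scope classical_set_scope.
Local Open Scope ring_scope.

(** * Improper integrals of nonnegative derivatives, and integrability on unions *)

Lemma is_derive_continuous {R : realType} (f : R -> R) (x df : R) :
  is_derive x 1 f df -> {for x, continuous f}.
Proof.
by move=> /@ex_derive dfx; apply/differentiable_continuous/derivable1_diffP.
Qed.

(** The open interval is exhausted by segments on which the usual fundamental theorem applies;
    monotone convergence passes to the limit. Only one-sided limits of [F] enter at the endpoints,
    so [f] may blow up there, as the integrands below do when [eta < 1]. *)
Lemma ge0_oo_FTC2 {R : realType} (f F : R -> R) (a b la lb : R) : a < b ->
  {in `]a, b[, forall x, 0 <= f x} ->
  {in `]a, b[, continuous f} ->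
  {in `]a, b[, forall x : R, is_derive x 1 F (f x)} ->
  F x @[x --> a^'+] --> la -> F x @[x --> b^'-] --> lb ->
  (\int[@lebesgue_measure R]_(x in `]a, b[) (f x)%:E = (lb - la)%:E)%E.
Proof.
move=> ab f0 cf dF Fa Fb.
(* With denominator at least 3, [2 * d n < b - a], so every segment from [a + d n] to [b - d n] is
   nondegenerate. *)
pose d n : R := (b - a) / n.+3%:R.
have d0 n : 0 < d n by rewrite divr_gt0// subr_gt0.
have ddecr n k : (n <= k)%N -> d k <= d n.
  by move=> nk; rewrite ler_pM2l ?subr_gt0// lef_pV2 ?posrE// ler_nat !ltnS.
have d2 n : d n + d n < b - a.
  rewrite -mulr2n -mulr_natl mulrCA gtr_pMr ?subr_gt0//.
  by rewrite ltr_pdivrMr// mul1r ltr_nat.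
have dcvg : d n @[n --> \oo] --> 0.
  rewrite -(mulr0 (b - a)); apply: cvgMr.
  have := @cvg_harmonic R; rewrite -(cvg_shiftn 2); apply: cvg_trans.
  by apply: near_eq_cvg; near=> n; rewrite /harmonic /= addn2.
pose I : nat -> set R := fun n => `[a + d n, b - d n]%classic.
have Isub n : I n `<=` `]a, b[%classic.
  move=> x; rewrite /I /= !in_itv/= => /andP[ax xb].
  by rewrite (lt_le_trans _ ax) ?ltrDl//= (le_lt_trans xb)// ltrBlDr ltrDl.
have Icov : \bigcup_n I n = `]a, b[%classic.
  apply/seteqP; split => [x [n _ /Isub]//|x]; rewrite /= in_itv/= => /andP[ax xb].
  have e0 : 0 < Num.min (x - a) (b - x) by rewrite lt_min !subr_gt0 ax.
  move/cvgr0Pnorm_lt : dcvg => /(_ _ e0)[N _ /(_ N (leqnn _))].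
  rewrite ger0_norm ?(ltW (d0 _))// lt_min => /andP[d1 d2'].
  exists N => //; rewrite /I /= in_itv/= -lerBrDl (ltW d1)/= lerBrDr -lerBrDl.
  exact: ltW.
have cI n : {within I n, continuous f}.
  apply: continuous_in_subspaceT => x; rewrite inE => /Isub/= xab.
  exact: cf.
have mf n : measurable_fun (I n) f.
  by apply: subspace_continuous_measurable_fun => //; exact: measurable_itv.
have Iint n : (\int[@lebesgue_measure R]_(x in I n) (f x)%:E =
    (F (b - d n) - F (a + d n))%:E)%E.
  have adbd : a + d n < b - d n by have := d2 n; lra.
  have dFI : {in `[a + d n, b - d n], forall x : R, is_derive x 1 F (f x)}.
    by move=> x xI; apply: dF; exact: Isub xI.
  have dFI' : {in `[a + d n, b - d n], forall x : R, derivable F x 1}.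
    by move=> x /dFI/@ex_derive.
  have := derivable_within_continuous dFI'.
  move=> /(continuous_within_itvP _ adbd)[_ Fl Fr].
  rewrite (@continuous_FTC2 R f F)//.
  - exact: cI.
  - split => // x xI; apply: dFI'; exact: subset_itv_oo_cc xI.
  - move=> x xI; rewrite derive1E.
    by have /dFI/@derive_val := subset_itv_oo_cc xI.
rewrite -Icov.
have IM : nondecreasing_seq I.
  move=> n k nk; rewrite subsetEset.
  by apply: subset_itvScc; rewrite bnd_simp lerD2l ?lerN2 ddecr.
have icvg : (\int[@lebesgue_measure R]_(x in I n) (f x)%:E @[n --> \oo] -->
    \int[@lebesgue_measure R]_(x in \bigcup_n I n) (f x)%:E)%E.
  apply: ge0_nondecreasing_set_cvg_integral => [|||n x /Isub xab] //.
  - by move=> n; rewrite /I; exact: measurable_itv.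
  - by move=> n; apply/measurable_EFinP; exact: mf.
  - by rewrite lee_fin f0.
rewrite -(cvg_lim _ icvg)//.
under eq_fun do rewrite Iint.
apply/cvg_lim => //; apply: cvg_EFin; first exact: nearW.
apply: cvgB.
- move/cvg_at_leftP : Fb; apply; split => [n|]; first by rewrite ltrBlDr ltrDl.
  by rewrite -[X in _ --> X](subr0 b); apply: cvgB => //; exact: cvg_cst.
- move/cvg_at_rightP : Fa; apply; split => [n|]; first by rewrite ltrDl.
  by rewrite -[X in _ --> X](addr0 a); apply: cvgD => //; exact: cvg_cst.
Unshelve. all: by end_near. Qed.

Lemma integrable_setU {d : measure_display} {T : measurableType d} {R : realType}
    (mu : {measure set T -> \bar R}) (A B : set T) (f : T -> \bar R) :
  measurable A -> measurable B ->
  mu.-integrable A f -> mu.-integrable B f -> mu.-integrable (A `|` B) f.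
Proof.
move=> mA mB /integrableP[mfA fA] /integrableP[mfB fB].
have mfU : measurable_fun (A `|` B) f by apply/measurable_funU.
apply/integrableP; split => //.
(* The union is made disjoint by writing it as [A] together with [B] minus [A]. *)
rewrite -[A `|` B]setD0 -(setDv A) -setUDr ge0_integral_setU//=.
- rewrite lte_add_pinfty// (le_lt_trans _ fB)//.
  apply: ge0_subset_integral => //; first exact: measurableD.
  exact: measurableT_comp.
- exact: measurableD.
- by rewrite setUDr setDv setD0; exact: measurableT_comp.
- by apply/disj_setPS => x [? []].
Qed.

(** * The kernel [(1 - t) ^ (eta - 1)] on [0, 1] *)

Lemma measurable_onem_powR {R : realType} (a : R) (D : set R) :
  measurable_fun D (fun t => (1 - t) `^ a).
Proof.
apply: measurable_funTS.
apply: (@measurableT_comp _ _ _ _ _ _ (@powR R ^~ a)); first exact: measurable_powR.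
by apply: measurable_funB.
Qed.

Lemma integral_onem_powR {R : realType} (eta : R) : 0 < eta ->
  (\int[@lebesgue_measure R]_(t in `[0%R, 1%R]) ((1 - t) `^ (eta - 1))%:E = eta^-1%:E)%E.
Proof.
move=> eta0.
have mw D : measurable_fun D (fun t : R => ((1 - t) `^ (eta - 1))%:E).
  by apply/measurable_EFinP; exact: measurable_onem_powR.
(* Dropping the two endpoints, a null set, leaves the open interval, where [- (1 - t) ^ eta / eta]
   is a primitive. Its left limit at 1 is 0 because [eta > 0]. *)
rewrite -integral_itv_obnd_cbnd// -integral_itv_bndo_bndc//.
have dF (x : R) : x < 1 ->
    is_derive x 1 (fun t => - eta^-1 * (1 - t) `^ eta) ((1 - x) `^ (eta - 1)).
  move=> x1; have x10 : 0 < 1 - x by rewrite subr_gt0.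
  have d1 : is_derive x 1 (fun t : R => 1 - t) (0 - 1) by exact: is_deriveB.
  have d2 := @is_derive1_comp R (@powR R ^~ eta) (fun t => 1 - t) x _ _
    (is_derive1_powR eta x10) d1.
  apply: (is_derive_eq (is_deriveZ (- eta^-1) d2)).
  by rewrite /GRing.scale/=; field; rewrite gt_eqF.
have -> : eta^-1 = 0 - - eta^-1 * (1 - 0) `^ eta :> R.
  by rewrite sub0r subr0 powR1 mulr1 opprK.
apply: (ge0_oo_FTC2 _ (fun t => - eta^-1 * (1 - t) `^ eta)) => //.
- by move=> x _; rewrite powR_ge0.
- move=> x; rewrite in_itv/= => /andP[_ x1].
  apply: (continuous_comp (f := fun t : R => 1 - t) (g := fun t => t `^ (eta - 1))).
    by apply: cvgB; [exact: cvg_cst|exact: cvg_id].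
  by apply: is_derive_continuous; apply: is_derive1_powR; rewrite subr_gt0.
- by move=> x; rewrite in_itv/= => /andP[_]; exact: dF.
- apply: cvg_at_right_filter; exact: (is_derive_continuous _ _ _ (dF 0 ltr01)).
- rewrite -(mulr0 (- eta^-1)); apply: cvgMr.
  apply/cvg_at_leftP => u [u1 ucvg].
  have /cvg_at_rightP := powR_cvg0 eta0; apply; split => [n|].
    by rewrite subr_gt0.
  by rewrite -(subrr 1); apply: cvgB => //; exact: cvg_cst.
Qed.

Lemma integrable_onem_powR {R : realType} (eta : R) : 0 < eta ->
  (@lebesgue_measure R).-integrable `[0%R, 1%R]
    (EFin \o (fun t => (1 - t) `^ (eta - 1))).
Proof.
move=> eta0; apply/integrableP; split.
  by apply/measurable_EFinP; exact: measurable_onem_powR.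
apply: (@le_lt_trans _ _ eta^-1%:E); last exact: ltry.
rewrite -integral_onem_powR// le_eqVlt; apply/orP; left; apply/eqP/eq_integral.
by move=> t _; rewrite /= ger0_norm ?powR_ge0.
Qed.

(** * Convergence and functional equation of the Gamma integral *)

Section Gamma_shift.
Context {R : realType} (eta : R) (eta0 : 0 < eta).
Local Notation mu := (@lebesgue_measure R).
Let g (t : R) := t `^ (eta - 1) * expR (- t).
Let k (t : R) := t `^ eta * expR (- t).

Let kE (t : R) : 0 < t -> k t = t * g t.
Proof. by move=> t0; rewrite /k /g mulrA mulr_powRB1// ltW. Qed.

Let is_derive_powR_expRN (a t : R) : 0 < t ->
  is_derive t 1 (fun u => u `^ a * expR (- u))
    (a * (t `^ (a - 1) * expR (- t)) - t `^ a * expR (- t)).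
Proof.
move=> t0.
have dN : is_derive t 1 (fun u : R => - u) (- 1) by exact: is_deriveN.
have dE := @is_derive1_comp R expR (fun u => - u) t _ _ (is_derive_expR _) dN.
apply: (is_derive_eq (is_deriveM (is_derive1_powR a t0) dE)).
by rewrite /GRing.scale/=; ring.
Qed.

Let dk (t : R) : 0 < t -> is_derive t 1 k (eta * g t - k t).
Proof. exact: is_derive_powR_expRN. Qed.

Let cg (t : R) : 0 < t -> {for t, continuous g}.
Proof. by move=> /(is_derive_powR_expRN (eta - 1))/is_derive_continuous. Qed.

Let ck (t : R) : 0 < t -> {for t, continuous k}.
Proof. by move=> /dk/is_derive_continuous. Qed.

Let cgk (t : R) : 0 < t -> {for t, continuous (fun u => eta * g u - k u)}.
Proof.
by move=> t0; apply: cvgB; [apply: cvgMr; exact: cg|exact: ck].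
Qed.

Let cvg_k0 : k t @[t --> (0 : R)^'+] --> 0.
Proof.
rewrite -[X in _ --> X](mul0r (expR (- 0))).
apply: (@cvgM _ _ _ _ (@powR R ^~ eta) (fun t => expR (- t))).
  exact: powR_cvg0.
apply: cvg_at_right_filter; apply: (continuous_comp (f := -%R) (g := @expR R)).
  exact: oppr_continuous.
exact: continuous_expR.
Qed.

Let cvg_ky : k t @[t --> +oo] --> 0.
Proof.
(* From [ln u <= u - 1] at [u = t / (2 * eta)] one gets [eta * ln t <= C + t / 2], hence
   [k t <= expR C * expR (- (t / 2))]. *)
pose C := eta * ln (2 * eta) - eta.
have cvgE : expR C * expR (- (t / 2)) @[t --> +oo] --> 0.
  rewrite -(mulr0 (expR C)); apply: cvgMr.
  apply: (@cvg_comp _ _ _ (fun t : R => t / 2) (fun u => expR (- u)) _ +oo).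
    by apply: gt0_cvgMly => //; rewrite invr_gt0.
  exact: cvgr_expR.
apply: (squeeze_cvgr _ (cvg_cst 0) cvgE).
near=> t.
have t0 : 0 < t by near: t; exact: nbhs_pinfty_gt.
rewrite mulr_ge0 ?powR_ge0 ?expR_ge0//= /k /powR gt_eqF// -!expRD ler_expR.
have e20 : 0 < 2 * eta by rewrite mulr_gt0.
have : ln (1 + (t / (2 * eta) - 1)) <= t / (2 * eta) - 1.
  by apply: le_ln1Dx; rewrite ltrBrDl subrr divr_gt0.
rewrite subrKC ln_div ?posrE// -(ler_pM2l eta0) => h.
have -> : t / 2 = eta * (t / (2 * eta)) by field; rewrite gt_eqF.
have : eta * (t / (2 * eta)) * 2 = t by field; rewrite gt_eqF.
by rewrite /C; move: h; rewrite !mulrBr mulr1; lra.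
Unshelve. all: by end_near. Qed.

(* The derivative [eta g - k] of [k] has constant sign on each side of [eta],
   so the FTC for nonnegative functions applies on both sides; moreover
   [g <= 2 / eta * `|eta g - k|] away from [eta], whence integrability. *)
Let diff_integralS :
  (\int[mu]_(t in `]0%R, eta[) (eta * g t - k t)%:E = (k eta)%:E)%E.
Proof.
rewrite -[k eta]subr0; apply: (ge0_oo_FTC2 _ k) => //.
- move=> t; rewrite in_itv/= => /andP[t0 te].
  by rewrite kE// -mulrBl mulr_ge0 ?subr_ge0 ?(ltW te)// mulr_ge0 ?powR_ge0 ?expR_ge0.
- by move=> t; rewrite in_itv/= => /andP[t0 _]; exact: cgk.
- by move=> t; rewrite in_itv/= => /andP[t0 _]; exact: dk.
- by apply: cvg_at_left_filter; exact: ck.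
Qed.

Let diff_integraly :
  (\int[mu]_(t in `[eta, +oo[) (k t - eta * g t)%:E = (k eta)%:E)%E.
Proof.
have pos (t : R) : eta <= t -> 0 < t by exact: lt_le_trans.
have dNk (t : R) : 0 < t -> is_derive t 1 (fun u => - k u) (k t - eta * g t).
  by move=> /dk dkt; apply: (is_derive_eq (is_deriveN dkt)); rewrite opprB.
rewrite (@ge0_continuous_FTC2y R _ (fun u => - k u) eta 0).
- by rewrite -EFinB opprK add0r.
- move=> t et; rewrite kE ?pos// -mulrBl mulr_ge0 ?subr_ge0//.
  by rewrite mulr_ge0 ?powR_ge0 ?expR_ge0.
- apply: continuous_in_subspaceT => t; rewrite inE/= in_itv/= andbT => /pos t0.
  by apply: cvgB; [exact: ck|apply: cvgMr; exact: cg].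
- by rewrite -oppr0; apply: cvgN; exact: cvg_ky.
- by move=> t /ltW/pos/dNk/@ex_derive.
- by apply: cvg_at_right_filter; apply: cvgN; exact: ck.
- move=> t; rewrite in_itv/= andbT => /ltW/pos/dNk dt.
  by rewrite derive1E derive_val.
Qed.

Let measurable_powR_expRN (a : R) (D : set R) :
  measurable_fun D (fun u => u `^ a * expR (- u)).
Proof.
apply: measurable_funTS; apply: measurable_funM; first exact: measurable_powR.
by apply: measurableT_comp.
Qed.

(** For [t > 0] this is both minus the derivative of [k] and, by [kE], [(t - eta) * g t]. The first
    form yields its integral, the second its sign and a bound on [g] far from [eta]. *)
Let h (t : R) := k t - eta * g t.

Let mh D : measurable_fun D h.
Proof.
apply: measurable_funB; first exact: measurable_powR_expRN.
by apply: measurable_funM => //; exact: measurable_powR_expRN.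
Qed.

Let integrable_hS : mu.-integrable `]0%R, eta[ (EFin \o h).
Proof.
apply/integrableP; split; first by apply/measurable_EFinP; exact: mh.
apply: (@le_lt_trans _ _ (k eta)%:E); last exact: ltry.
rewrite -diff_integralS le_eqVlt; apply/orP; left; apply/eqP/eq_integral => t.
rewrite inE/= in_itv/= => /andP[t0 te].
rewrite /h kE// -mulrBl normrM ler0_norm ?subr_le0 ?(ltW te)//.
by rewrite ger0_norm ?mulr_ge0 ?powR_ge0 ?expR_ge0// opprB mulrBl.
Qed.

Let integrable_hy : mu.-integrable `[eta, +oo[ (EFin \o h).
Proof.
apply/integrableP; split; first by apply/measurable_EFinP; exact: mh.
apply: (@le_lt_trans _ _ (k eta)%:E); last exact: ltry.
rewrite -diff_integraly le_eqVlt; apply/orP; left; apply/eqP/eq_integral => t.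
rewrite inE/= in_itv/= andbT => et.
rewrite /h kE ?(lt_le_trans eta0)// -mulrBl normrM ger0_norm ?subr_ge0//.
by rewrite ger0_norm ?mulr_ge0 ?powR_ge0 ?expR_ge0.
Qed.

Let itv0yE : `]0, +oo[%classic = `]0, eta[%classic `|` `[eta, +oo[%classic :> set R.
Proof. by rewrite -itv_bndbnd_setU// bnd_simp ltW. Qed.

Let integrable_h : mu.-integrable `]0%R, +oo[ (EFin \o h).
Proof. by rewrite itv0yE; apply: integrable_setU. Qed.

Let g_ge0 (t : R) : 0 <= g t.
Proof. by rewrite mulr_ge0 ?powR_ge0 ?expR_ge0. Qed.

Let integrable_far (i : interval R) : [set` i] `<=` `]0, +oo[%classic ->
  {in i, forall t : R, eta / 2 <= `|t - eta|} ->
  mu.-integrable [set` i] (EFin \o g).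
Proof.
move=> i0 ieta; have mi : measurable [set` i] by exact: measurable_itv.
have hi : mu.-integrable [set` i] (EFin \o h) by exact: integrableS integrable_h.
apply: (le_integrable _ _ _ (integrableZl _ (2 / eta) hi)) => //.
  by apply/measurable_EFinP; exact: measurable_powR_expRN.
move=> t it; have := i0 _ it; rewrite /= in_itv/= andbT => t0.
rewrite lee_fin /h kE// -mulrBl (normrM (2 / eta)) (normrM (t - eta)).
rewrite (ger0_norm (g_ge0 t)) mulrA.
rewrite ler_peMl// ger0_norm ?divr_ge0 ?(ltW eta0)//.
have {1}<- : 2 / eta * (eta / 2) = 1 by field; rewrite gt_eqF.
by rewrite ler_wpM2l ?divr_ge0 ?(ltW eta0)// ieta.
Qed.

Lemma integrable_Gamma : mu.-integrable `]0%R, +oo[ (EFin \o g).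
Proof.
(* Outside [[a, b]] the distance to [eta] is at least [eta / 2], so [g] is dominated by a multiple
   of [h]; on the compact [[a, b]], which avoids 0, [g] is continuous. *)
pose a := eta / 2; pose b := eta + eta / 2.
have a0 : 0 < a by rewrite divr_gt0.
have ab : a <= b by rewrite /a /b lerDr ltW.
rewrite (_ : `]0, +oo[%classic = `]0, a[ `|` (`[a, b] `|` `]b, +oo[))%classic; last first.
  rewrite -itv_bndbnd_setU ?bnd_simp//.
  by rewrite -itv_bndbnd_setU// bnd_simp ltW.
apply: integrable_setU => //; last apply: integrable_setU => //.
- exact: measurableU.
- apply: integrable_far => [t|t]; rewrite /= !in_itv/= => /andP[t0 ta].
    by rewrite t0.
  by rewrite distrC ler_normr; apply/orP; left; move: ta; rewrite /a; lra.
- apply: continuous_compact_integrable; first exact: segment_compact.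
  apply: continuous_in_subspaceT => t; rewrite inE/= in_itv/= => /andP[at_ _].
  by apply: cg; exact: lt_le_trans at_.
- apply: integrable_far => [t|t]; rewrite /= !in_itv/= !andbT => bt.
    by rewrite (lt_trans _ bt)// (lt_le_trans a0).
  by rewrite ler_normr; apply/orP; left; move: bt; rewrite /b; lra.
Qed.

(** The integrals of [h] to the left and right of [eta] are [- k eta] and [k eta]. They cancel, so
    [k] and [eta * g] have the same integral. *)
Lemma GammaS : Gamma (eta + 1) = eta * Gamma eta.
Proof.
have ig := integrable_Gamma.
have ieg : mu.-integrable `]0%R, +oo[ (EFin \o (fun t => eta * g t)).
  exact: (integrableZl _ eta ig).
have hS : \int[mu]_(t in `]0, eta[) h t = - k eta.
  apply: oppr_inj; rewrite opprK -mulN1r -RintegralZl//.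
  rewrite /Rintegral -[RHS]/(fine (k eta)%:E) -diff_integralS; congr fine.
  by apply: eq_integral => t _; rewrite mulN1r opprB.
have hy : \int[mu]_(t in `[eta, +oo[) h t = k eta.
  by rewrite /Rintegral diff_integraly.
have : \int[mu]_(t in `]0, +oo[) h t = 0.
  rewrite itv0yE Rintegral_setU// ?hS ?hy ?addNr -?itv0yE//.
  apply/disj_setPS => t []; rewrite /= !in_itv/= andbT => /andP[_ te].
  by rewrite leNgt te.
have ik : mu.-integrable `]0%R, +oo[ (EFin \o k).
  rewrite (_ : EFin \o k = (fun t => (EFin \o h) t + (eta * g t)%:E)%E).
    exact: integrableD.
  by apply/funext => t; rewrite /= -EFinD subrK.
rewrite RintegralB// RintegralZl// => /eqP; rewrite subr_eq0 => /eqP <-.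
by rewrite /Gamma addrK.
Qed.

End Gamma_shift.

(** * Strict positivity of integrals and of Gamma *)

Lemma Rintegral_gt0 {d : measure_display} {T : measurableType d} {R : realType}
    (mu : {measure set T -> \bar R}) (D N : set T) (f : T -> R) :
  measurable D -> measurable N -> mu N = 0%E -> (0 < mu D)%E ->
  mu.-integrable D (EFin \o f) ->
  (forall x, D x -> 0 <= f x) -> (forall x, (D `\` N) x -> 0 < f x) ->
  0 < \int[mu]_(x in D) f x.
Proof.
move=> mD mN N0 D0 intf f0 fpos.
rewrite lt_neqAle Rintegral_ge0// andbT eq_sym; apply/negP => /eqP intf0.
have mf : measurable_fun D (EFin \o f) by exact: measurable_int intf.
(* A zero integral would make [f] vanish almost everywhere on [D], so that [D] lies in the union of
   a null set [A] and [N], against [0 < mu D]. *)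
have : (\int[mu]_(x in D) `|(EFin \o f) x| = 0)%E.
  rewrite -[RHS]/(0%:E) -intf0 fineK ?integrable_fin_num//.
  by apply: eq_integral => x /[!inE] Dx; rewrite /= ger0_norm// f0.
move=> /(ae_eq_integral_abs mu mD mf)[A [mA A0 DA]].
have : (mu D <= mu (A `|` N))%E.
  apply: le_measure; rewrite ?inE//; first exact: measurableU.
  move=> x Dx; have [Nx|nNx] := pselect (N x); [by right|left; apply: DA => /(_ Dx)[fx0]].
  by have := fpos x (conj Dx nNx); rewrite fx0 ltxx.
rewrite leNgt => /negP; apply; apply: le_lt_trans D0.
by rewrite [X in (X <= _)%E](null_set_setU mA mN).
Qed.

Lemma Gamma_gt0 {R : realType} (eta : R) : 0 < eta -> 0 < Gamma eta.
Proof.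
move=> eta0; apply: (Rintegral_gt0 _ _ set0) => //.
- by rewrite [X in (_ < X)%E](lebesgue_measure_itv `]0%R, +oo[)/= ltry addye// lt0y.
- exact (integrable_Gamma _ eta0).
- by move=> t _; rewrite mulr_ge0 ?powR_ge0 ?expR_ge0.
- move=> t [+ _]; rewrite /= in_itv/= andbT => t0.
  by rewrite mulr_gt0 ?powR_gt0 ?expR_gt0.
Qed.

(** * The basis functions form a partition of unity *)

Lemma qbasis_ge0 (R : realType) (m j : nat) (alpha : R) (s : nat) (z : R) :
  0 <= alpha <= 1 -> 0 <= z <= 1 -> 0 <= qbasis m j alpha s z.
Proof.
move=> /andP[a0 a1] /andP[z0 z1].
have bern k p q : 0 <= k%:R * z ^+ p * (1 - z) ^+ q :> R.
  by rewrite !mulr_ge0 ?exprn_ge0 ?subr_ge0.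
rewrite /qbasis; case: ifP => // _.
have scaled c k p q : 0 <= c -> 0 <= c * k%:R * z ^+ p * (1 - z) ^+ q :> R.
  by move=> c0; rewrite -!mulrA mulr_ge0// mulrA.
by rewrite !addr_ge0 ?scaled ?subr_ge0//; case: ifP => // _; rewrite scaled ?subr_ge0.
Qed.

Lemma sum_bernstein (R : realType) (n : nat) (z : R) :
  \sum_(0 <= j < n.+1) 'C(n, j)%:R * z ^+ j * (1 - z) ^+ (n - j) = 1.
Proof.
rewrite -[RHS](expr1n _ n) -[X in _ = X ^+ _](subrK z) exprDn big_mkord.
by apply: eq_bigr => i _; rewrite -mulr_natl; ring.
Qed.

(** When [s <= m], each of the three summands of [qbasis] is a multiple of a Bernstein sum; the
    totals are [(1 - alpha) * z], [(1 - alpha) * (1 - z)] and [alpha]. *)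
Lemma sum_qbasis (R : realType) (m : nat) (alpha : R) (s : nat) (z : R) :
  \sum_(0 <= j < m.+1) qbasis m j alpha s z = 1.
Proof.
rewrite /qbasis; case: ltnP => [_|sm]; first exact: sum_bernstein.
rewrite !big_split/=.
have -> : \sum_(0 <= j < m.+1) (if (s <= j)%N then
    (1 - alpha) * 'C(m - s, j - s)%:R * z ^+ (j - s + 1) * (1 - z) ^+ (m - j)
    else 0) = (1 - alpha) * z.
  (* Terms with [j < s] are 0; shifting the others by [s] gives the Bernstein sum of degree
     [m - s]. *)
  rewrite (@big_cat_nat _ _ _ s) ?leq0n//=; last exact: leqW.
  rewrite big_nat big1 ?add0r => [|j /andP[_ js]]; last by rewrite leqNgt js.
  rewrite -{1}(add0n s) big_addn subSn// -[RHS]mulr1 -[X in _ = _ * X](sum_bernstein R (m - s) z).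
  rewrite mulr_sumr; apply: eq_bigr => j _.
  by rewrite leq_addl addnK addn1 exprS (addnC j s) subnDA; ring.
have -> : \sum_(0 <= j < m.+1)
    (1 - alpha) * 'C(m - s, j)%:R * z ^+ j * (1 - z) ^+ (m - s - j + 1)
    = (1 - alpha) * (1 - z).
  (* Past [j = m - s] the binomial coefficient vanishes. *)
  rewrite (@big_cat_nat _ _ _ (m - s).+1)//=; last by rewrite ltnS leq_subr.
  rewrite [X in _ + X]big_nat [X in _ + X]big1 ?addr0 => [|j /andP[js _]]; last first.
    by rewrite bin_small// mulr0 !mul0r.
  rewrite -[RHS]mulr1 -[X in _ = _ * X](sum_bernstein R (m - s) z) mulr_sumr.
  by apply: eq_bigr => j _; rewrite addn1 exprS; ring.
under [X in _ + X]eq_bigr do rewrite -!mulrA.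
rewrite -mulr_sumr; under [X in _ + _ * X]eq_bigr do rewrite mulrA.
by rewrite sum_bernstein; ring.
Qed.

(** * Estimates by the modulus of continuity *)

Section modulus.
Context {R : realType} (phi : R -> R) (cphi : {within `[0, 1], continuous phi}).

(** Boundedness makes the [sup] in [modulus] a genuine supremum, and later makes integrands of the
    form weight times function integrable. *)
Lemma bounded_itv01 :
  exists2 M : R, 0 <= M & forall x : R, 0 <= x <= 1 -> `|phi x| <= M.
Proof.
have cn : {within `[0, 1], continuous (fun x => `|phi x|)}.
  by move=> x; apply: cvg_norm; exact: cphi.
have [c _ cP] := @EVT_max R (fun x => `|phi x|) 0 1 ler01 cn.
by exists `|phi c| => // x x01; apply: cP; rewrite in_itv.
Qed.

Lemma le_modulus (lambda x y : R) : 0 <= x <= 1 -> 0 <= y <= 1 ->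
  0 < lambda -> `|x - y| <= lambda -> `|phi x - phi y| <= modulus phi lambda.
Proof.
move=> x01 y01 l0 xyl.
have [M M0 phiM] := bounded_itv01.
set S := [set r : R | exists u h : R,
    [/\ 0 < h <= lambda, 0 <= u <= 1, 0 <= u + h <= 1
      & r = `|phi (u + h) - phi u|] ].
have ubS : has_ubound S.
  exists (M + M) => _ [u [h [_ u01 uh01 ->]]].
  by rewrite (le_trans (ler_normB _ _))// lerD// phiM.
have stepS u v : 0 <= u <= 1 -> 0 <= v <= 1 -> 0 < v - u <= lambda ->
    `|phi v - phi u| <= modulus phi lambda.
  move=> u01 v01 uv; apply: ub_le_sup => //; exists u, (v - u).
  by rewrite subrKC.
have [xy|yx|xy] := ltrgtP x y.
- rewrite distrC; apply: stepS => //.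
  by rewrite subr_gt0 xy (le_trans _ xyl)// distrC ler_norm.
- apply: stepS => //.
  by rewrite subr_gt0 yx (le_trans _ xyl)// ler_norm.
(* The set defining [modulus] admits only [h > 0], so [x = y] is not covered by a step;
   nonnegativity of [modulus] comes instead from a step of length [Num.min lambda 1] starting at
   0. *)
- rewrite xy subrr normr0.
  have [h [h0 hl h1]] : exists h : R, [/\ 0 < h, h <= lambda & h <= 1].
    by exists (Num.min lambda 1); rewrite lt_min l0 ltr01 !ge_min !lexx orbT.
  apply: (le_trans (normr_ge0 (phi (0 + h) - phi 0))); apply: stepS => //.
  + by rewrite lexx ler01.
  + by rewrite add0r (ltW h0).
  + by rewrite add0r subr0 h0.
Qed.

Lemma le_modulus_natmul (lambda : R) (n : nat) (x y : R) :
  0 <= x <= 1 -> 0 <= y <= 1 -> 0 < lambda -> `|x - y| <= n%:R * lambda ->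
  `|phi x - phi y| <= n%:R * modulus phi lambda.
Proof.
move=> + y01 l0; elim: n x => [|n IH] x x01 xy.
  move: xy; rewrite !mul0r !normr_le0 !subr_eq0 => /eqP ->.
  by rewrite eqxx.
(* The point [w] is one [(n + 1)]-th of the way from [x] to [y]: one step joins [x] to [w], and [n]
   steps remain to [y]. It stays in [0, 1] by convexity. *)
pose w := y + (x - y) * (n%:R / n.+1%:R).
have n1 : 0 < n.+1%:R :> R by rewrite ltr0n.
have t0 : 0 <= n%:R / n.+1%:R :> R by rewrite divr_ge0.
have t1 : n%:R / n.+1%:R <= 1 :> R by rewrite ler_pdivrMr// mul1r ler_nat.
have w01 : 0 <= w <= 1.
  by rewrite /w; move: x01 y01 t0 t1; set t := _ / _; clear; nra.
have wy : `|w - y| <= n%:R * lambda.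
  rewrite /w addrC addKr normrM (ger0_norm t0) mulrA ler_pdivrMr//.
  by rewrite mulrC -mulrA [lambda * _]mulrC ler_wpM2l.
have xw : `|x - w| <= lambda.
  have -> : x - w = (x - y) / n.+1%:R.
    rewrite /w; have -> : n%:R = n.+1%:R - 1 :> R by rewrite -natr1 addrK.
    by field; rewrite gt_eqF.
  by rewrite normrM normfV (ger0_norm (ltW n1)) ler_pdivrMr// mulrC.
rewrite -[X in `|X|](subrKA (phi w)) (le_trans (ler_normD _ _))//.
by rewrite -natr1 mulrDl mul1r addrC lerD ?IH// le_modulus.
Qed.

(* Off the range [|x - y| <= lambda] the number of steps is at most
   [1 + |x - y| / lambda <= 1 + (x - y)^2 / lambda^2]. *)
Lemma le_modulus_sqr (lambda x y : R) : 0 <= x <= 1 -> 0 <= y <= 1 ->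
  0 < lambda ->
  `|phi x - phi y| <= (1 + (x - y) ^+ 2 / lambda ^+ 2) * modulus phi lambda.
Proof.
move=> x01 y01 l0.
have w0 : 0 <= modulus phi lambda.
  rewrite (le_trans (normr_ge0 (phi y - phi y)))// le_modulus//.
  by rewrite subrr normr0 ltW.
pose r := `|x - y| / lambda.
have -> : (x - y) ^+ 2 / lambda ^+ 2 = r ^+ 2 by rewrite exprMn exprVn real_normK// num_real.
have r0 : 0 <= r by rewrite divr_ge0// ltW.
have [xy|xy] := leP `|x - y| lambda.
  apply: (le_trans (le_modulus _ _ _ x01 y01 l0 xy)).
  by rewrite ler_peMl// lerDl sqr_ge0.
have r1 : 1 < r by rewrite ltr_pdivlMr// mul1r.
have /andP[tr rt] := Num.Theory.truncn_itv r0.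
apply: (le_trans (le_modulus_natmul lambda (Num.truncn r).+1 x y x01 y01 l0 _)).
  by rewrite -ler_pdivrMr// ltW.
by rewrite ler_wpM2r// -nat1r lerD2l (le_trans tr)// expr2 ler_peMl// ltW.
Qed.

End modulus.

(** * Weighted integrals along the nodes [(j + t ^ gamma) / (m + 1)] *)

Lemma continuous_sqr_subr {R : realType} (z : R) (A : set R) :
  {within A, continuous (fun t : R => (t - z) ^+ 2)}.
Proof.
apply: continuous_subspaceT => t; apply: (@continuous_comp _ _ _ (fun t => t - z) (fun u => u ^+ 2)).
  by apply: cvgB; [exact: cvg_id|exact: cvg_cst].
exact: exprn_continuous.
Qed.

Section nodes.
Context {R : realType} (m : nat) (eta gamma : R) (eta0 : 0 < eta) (gamma0 : 0 < gamma).
Local Notation mu := (@lebesgue_measure R).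
Local Notation w t := ((1 - t) `^ (eta - 1) / Gamma eta).
Local Notation node j t := ((j%:R + t `^ gamma) / (m%:R + 1)).

Lemma node_itv01 (j : nat) (t : R) : (j <= m)%N -> 0 <= t <= 1 ->
  0 <= node j t <= 1.
Proof.
move=> jm /andP[t0 t1].
have tg1 : t `^ gamma <= 1.
  have <- : 1 `^ gamma = 1 :> R by rewrite powR1.
  by rewrite ge0_ler_powR ?nnegrE// ltW.
rewrite divr_ge0 ?addr_ge0 ?powR_ge0//= ler_pdivrMr ?ltr_wpDl// mul1r.
by rewrite lerD// ler_nat.
Qed.

Lemma measurable_node (j : nat) (D : set R) : measurable_fun D (fun t => node j t).
Proof.
apply: measurable_funM => //; apply: measurable_funD => //.
by apply: measurable_funTS; exact: measurable_powR.
Qed.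

Lemma integrable_weight : mu.-integrable `[0%R, 1%R] (EFin \o (fun t => w t)).
Proof.
rewrite (_ : EFin \o _ = fun t => ((Gamma eta)^-1%:E * ((1 - t) `^ (eta - 1))%:E)%E).
  exact: (integrableZl _ _ (integrable_onem_powR _ eta0)).
by apply/funext => t /=; rewrite mulrC EFinM.
Qed.

(** The weight is integrable and the other factor is bounded and measurable. Since [psi] is
    controlled only on [0, 1], this rests on the node mapping [0, 1] into itself. *)
Lemma integrable_node (psi : R -> R) (j : nat) : (j <= m)%N ->
  {within `[0, 1], continuous psi} ->
  mu.-integrable `[0%R, 1%R] (EFin \o (fun t => w t * psi (node j t))).
Proof.
move=> jm cpsi.
have [M _ psiM] := bounded_itv01 psi cpsi.
have iw := integrable_weight.
have mpsi : measurable_fun (`[0, 1]%classic : set R) (psi \o (fun t => node j t)).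
  apply: (@measurable_comp _ _ _ _ _ _ (`[0, 1]%classic : set R)) => //.
  - by move=> _ [t] + <-; rewrite /= !in_itv/=; exact: node_itv01.
  - by apply: subspace_continuous_measurable_fun => //; exact: measurable_itv.
  - exact: measurable_node.
rewrite (_ : EFin \o _ = (EFin \o (fun t => w t)) \* (EFin \o (psi \o (fun t => node j t))))%E//.
apply: integrableMl => //; exists M; split; first exact: num_real.
move=> N MN t /=; rewrite in_itv/= => t01.
by rewrite (le_trans (psiM _ (node_itv01 _ _ jm t01)))// ltW.
Qed.

(** This is why the prefactor [Gamma (eta + 1)] of [frac_op] makes it preserve constants. *)
Lemma Rintegral_weight : \int[mu]_(t in `[0, 1]) (w t) = (Gamma (eta + 1))^-1.
Proof.
rewrite RintegralZr//; last exact: integrable_onem_powR.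
by rewrite /Rintegral integral_onem_powR// GammaS// invfM mulrC.
Qed.

Lemma Rintegral_node_sqr_gt0 (j : nat) (z : R) : (j <= m)%N ->
  0 < \int[mu]_(t in `[0, 1]) (w t * (node j t - z) ^+ 2).
Proof.
move=> jm; have G0 := Gamma_gt0 _ eta0.
(* Solving [node j t = z] for [t >= 0] can only give [t = c]. The point 1 is excluded as well,
   because there the weight has base 0 and vanishes unless [eta = 1]. *)
pose c := ((m%:R + 1) * z - j%:R) `^ gamma^-1.
apply: (Rintegral_gt0 mu _ ([set 1] `|` [set c])) => //.
- exact: measurableU.
- by apply: null_set_setU => //; exact: lebesgue_measure_set1.
- by rewrite [X in (_ < X)%E](lebesgue_measure_itv `[0%R, 1%R])/= lte_fin ltr01 sube0.
- exact (integrable_node _ j jm (continuous_sqr_subr z _)).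
- by move=> t _; rewrite mulr_ge0 ?sqr_ge0 ?divr_ge0 ?powR_ge0 ?ltW.
move=> t [] /=; rewrite in_itv/= => /andP[t0 t1] /not_orP[tn1 tnc].
rewrite mulr_gt0 ?divr_gt0 ?powR_gt0//.
  by rewrite subr_gt0 lt_neqAle t1 andbT; apply/eqP.
rewrite exprn_even_gt0//= subr_eq0; apply/eqP => tz; apply: tnc.
rewrite /c -tz mulrC divfK ?gt_eqF ?ltr_wpDl// addrC addKr -powRrM.
by rewrite divff ?powRr1// gt_eqF.
Qed.

Lemma le_Rintegral_node (phi : R -> R) (z lambda : R) (j : nat) :
  {within `[0, 1], continuous phi} -> 0 <= z <= 1 -> 0 < lambda -> (j <= m)%N ->
  `|\int[mu]_(t in `[0, 1]) (w t * phi (node j t)) - phi z / Gamma (eta + 1)|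
  <= ((Gamma (eta + 1))^-1 +
      (\int[mu]_(t in `[0, 1]) (w t * (node j t - z) ^+ 2)) / lambda ^+ 2)
     * modulus phi lambda.
Proof.
move=> cphi z01 l0 jm; have G0 := Gamma_gt0 _ eta0.
have w0 (t : R) : 0 <= w t by rewrite divr_ge0 ?powR_ge0 ?ltW.
have ccst (c : R) : {within `[0, 1], continuous (fun _ : R => c)}.
  by apply: continuous_subspaceT => t; exact: cvg_cst.
have iphi := integrable_node phi j jm cphi.
have iw c := integrable_node (fun=> c) j jm (ccst c).
have isq := integrable_node _ j jm (continuous_sqr_subr z _).
have idiff : mu.-integrable `[0%R, 1%R]
    (EFin \o (fun t => w t * phi (node j t) - w t * phi z)).
  by refine (integrableB _ iphi (iw (phi z))).
have ibound : mu.-integrable `[0%R, 1%R] (EFin \o (fun t =>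
    w t * modulus phi lambda +
    (modulus phi lambda / lambda ^+ 2) * (w t * (node j t - z) ^+ 2))).
  by refine (integrableD _ (iw (modulus phi lambda))
    (integrableZl _ (modulus phi lambda / lambda ^+ 2) isq)).
have iw1 := integrable_weight.
(* Once the constant is an integral against the same weight, [le_modulus_sqr] can be applied
   pointwise under the integral. *)
have -> : phi z / Gamma (eta + 1) = \int[mu]_(t in `[0, 1]) (w t * phi z).
  by rewrite RintegralZr// Rintegral_weight mulrC.
rewrite -RintegralB// (le_trans (le_normr_Rintegral _ _))//.
apply: (@le_trans _ _ (\int[mu]_(t in `[0, 1]) (w t * modulus phi lambda +
    (modulus phi lambda / lambda ^+ 2) * (w t * (node j t - z) ^+ 2)))).
  apply: le_Rintegral => //; first exact: integrable_norm.
  move=> t; rewrite /= in_itv/= => t01.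
  rewrite -mulrBr normrM (ger0_norm (w0 t)) mulrCA -mulrDr ler_wpM2l//.
  apply: (le_trans (le_modulus_sqr phi cphi lambda _ _ (node_itv01 _ _ jm t01) z01 l0)).
  by rewrite le_eqVlt; apply/orP; left; apply/eqP; ring.
rewrite RintegralD//; last by refine (integrableZl _ _ isq).
rewrite RintegralZr// RintegralZl// Rintegral_weight.
by rewrite le_eqVlt; apply/orP; left; apply/eqP; ring.
Qed.

End nodes.

(** * The operator: positive second moment and error bound *)

Section frac_op.
Context {R : realType} (m s : nat) (eta gamma alpha z : R).
Context (eta0 : 0 < eta) (gamma0 : 0 < gamma).
Context (alpha01 : 0 <= alpha <= 1) (z01 : 0 <= z <= 1).
Local Notation q j := (qbasis m j alpha s z).

Lemma second_moment_gt0 : 0 < second_moment m eta gamma alpha s z.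
Proof.
have I0 j : (j < m.+1)%N -> 0 < _ := Rintegral_node_sqr_gt0 m eta gamma eta0 gamma0 j z.
rewrite /second_moment /frac_op mulr_gt0 ?Gamma_gt0 ?addr_gt0//.
rewrite big_mkord lt_neqAle sumr_ge0 ?andbT => [|j _]; last first.
  by rewrite mulr_ge0 ?qbasis_ge0// ltW// I0.
(* If the sum of nonnegative terms were 0, the positive integrals would force every [q j] to be 0,
   although they sum to 1. *)
rewrite eq_sym; apply/negP; rewrite psumr_eq0 => [/allP q0|j _]; last first.
  by rewrite mulr_ge0 ?qbasis_ge0// ltW// I0.
have := sum_qbasis R m alpha s z; rewrite big_mkord big1 => [|j _].
  by move/eqP; rewrite eq_sym oner_eq0.
have := q0 j (mem_index_enum j); rewrite /= mulf_eq0 => /orP[/eqP//|].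
by rewrite gt_eqF// I0.
Qed.

(** Both [phi z] and the factor on the right are rewritten as [Gamma (eta + 1)] times a sum weighted
    by the [q j]; the inequality then follows term by term from [le_Rintegral_node]. *)
Lemma le_frac_op (phi : R -> R) (lambda : R) :
  {within `[0, 1], continuous phi} -> 0 < lambda ->
  `|frac_op m eta gamma alpha s phi z - phi z| <=
  (1 + second_moment m eta gamma alpha s z / lambda ^+ 2) * modulus phi lambda.
Proof.
move=> cphi l0; have G1 : 0 < Gamma (eta + 1) by rewrite Gamma_gt0// addr_gt0.
have q1 := sum_qbasis R m alpha s z.
have phizE : phi z = Gamma (eta + 1) *
    \sum_(0 <= j < m.+1) q j * (phi z / Gamma (eta + 1)).
  by rewrite -mulr_suml q1 mul1r mulrC divfK ?gt_eqF.
pose I j := \int[@lebesgue_measure R]_(t in `[0, 1])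
  ((1 - t) `^ (eta - 1) / Gamma eta
   * ((j%:R + t `^ gamma) / (m%:R + 1) - z) ^+ 2).
have boundE : 1 + second_moment m eta gamma alpha s z / lambda ^+ 2 =
    Gamma (eta + 1) *
    \sum_(0 <= j < m.+1) q j * ((Gamma (eta + 1))^-1 + I j / lambda ^+ 2).
  under eq_bigr do rewrite mulrDr mulrA.
  by rewrite big_split/= -!mulr_suml q1 mul1r mulrDr divff ?gt_eqF// mulrA.
rewrite boundE phizE /frac_op -mulrBr -sumrB normrM (gtr0_norm G1).
rewrite -mulrA ler_pM2l// mulr_suml (le_trans (ler_norm_sum _ _ _))//.
rewrite !big_mkord; apply: ler_sum => j _.
rewrite -mulrBr -mulrA normrM (ger0_norm (qbasis_ge0 _ _ _ _ _ _ _ _))//.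
by rewrite ler_wpM2l ?qbasis_ge0// le_Rintegral_node// -ltnS.
Qed.

End frac_op.

Theorem theorem3 (R : realType) (m : nat) (eta gamma alpha : R) (s : nat)
    (phi : R -> R) (z : R) (hm : (0 < m)%N) (heta : 0 < eta)
    (hgamma : 0 < gamma) (halpha : 0 <= alpha <= 1)
    (hphi : {within `[0, 1], continuous phi}) (hz : 0 <= z <= 1) :
  `|frac_op m eta gamma alpha s phi z - phi z|
    <= 2 * modulus phi (Num.sqrt (second_moment m eta gamma alpha s z)).
Proof.
have M0 := second_moment_gt0 m s eta gamma alpha z heta hgamma halpha hz.
have s0 : 0 < Num.sqrt (second_moment m eta gamma alpha s z) by rewrite sqrtr_gt0.
apply: (le_trans (le_frac_op m s eta gamma alpha z heta hgamma halpha hz phi _ hphi s0)).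
by rewrite sqr_sqrtr ?(ltW M0)// divff ?gt_eqF// -mulr2n.
Qed.
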